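(* Let $\bm\Psi\in\mathbb{R}^{M\times K}$ be the truncated DCT basis. Suppose that the sampling set $\mathcal S_{\mathrm u}=\{s_1,\dots,s_{N_s}\}\subseteq\{1,\dots,M\}$ satisfies the midpoint-alignment condition $$\frac{s_i-\frac12}{M}=\frac{i-\frac12}{N_s},\qquad i=1,\dots,N_s.$$ If $K\le N_s$, then the sampled basis matrix $\bm\Psi_{\mathcal S_{\mathrm u}}$ satisfies $$\bm\Psi_{\mathcal S_{\mathrm u}}^\top\bm\Psi_{\mathcal S_{\mathrm u}}=\frac{N_s}{M}\bm I_K.$$ Consequently, all singular values of $\bm\Psi_{\mathcal S_{\mathrm u}}$ are equal to $\sqrt{N_s/M}$, and, under independent Gaussian measurement noise, i.e. $\bm y=\bm\Psi_{\mathcal S_{\mathrm u}}\bm\omega+\bm z$ with deterministic $\bm\omega\in\mathbb{R}^K$ and $\bm z\sim\mathcal N(\bm 0,\sigma^2\bm I)$, the estimator $\widehat{\bm\omega}=(\bm\Psi_{\mathcal S_{\mathrm u}}^\top\bm\Psi_{\mathcal S_{\mathrm u}})^{-1}\bm\Psi_{\mathcal S_{\mathrm u}}^\top\bm y$ has covariance $$\mathrm{Cov}(\widehat{\bm\omega})=\sigma^2\frac{M}{N_s}\bm I_K.$$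
   Context: The truncated DCT basis $\bm\Psi\in\mathbb{R}^{M\times K}$, $1\le K\le M$, has entries $[\bm\Psi]_{m,k}=\rho_k\cos\left[\frac{\pi}{M}(m-\frac12)(k-1)\right]$ for $m=1,\dots,M$, $k=1,\dots,K$, with $\rho_1=\sqrt{1/M}$ and $\rho_k=\sqrt{2/M}$ for $k>1$ (the first $K$ columns of the orthonormal DCT-II matrix). For an index set $\mathcal S\subseteq\{1,\dots,M\}$, $\bm\Psi_{\mathcal S}$ is the $|\mathcal S|\times K$ submatrix of rows of $\bm\Psi$ indexed by $\mathcal S$. $\sigma^2>0$ is the noise variance. *)

(* Defs.v *)
From HB Require Import structures.
From mathcomp Require Import all_boot all_order all_algebra.
From mathcomp Require Import all_classical all_reals all_analysis.

Set Implicit Arguments.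
Unset Strict Implicit.
Unset Printing Implicit Defensive.

Import Order.TTheory GRing.Theory Num.Theory.

Local Open Scope ring_scope.

(* Indices are 0-based: i : 'I_n stands for the 1-based index i.+1. *)

Definition dct_scale (R : realType) (M k : nat) : R :=
  if k == 0%N then Num.sqrt (1 / M%:R) else Num.sqrt (2 / M%:R).

(* With 0-based indices, m - 1/2 becomes m.+1 - 1/2 and k - 1 becomes k. *)
Definition dct_basis (R : realType) (M K : nat) : 'M[R]_(M, K) :=
  \matrix_(m < M, k < K)
    (dct_scale R M k * cos (pi / M%:R * (m.+1%:R - 2^-1) * k%:R)).

(* The rows keep their relative order, since enum_val enumerates S in
   increasing order. *)
Definition rows_of (R : realType) (M K : nat) (S : {set 'I_M})
    (A : 'M[R]_(M, K)) : 'M[R]_(#|S|, K) :=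
  rowsub (fun i : 'I_#|S| => enum_val i) A.

Definition midpoint_aligned (R : realType) (M N : nat) (s : 'I_N -> 'I_M) :
    Prop :=
  forall i : 'I_N,
    ((s i).+1%:R - 2^-1) / M%:R = (i.+1%:R - 2^-1) / N%:R :> R.

(* The columns u and v are left and right singular vectors for a.  Unit length
   is written u^T *m u = 1%:M because the library norm on matrices is the sup
   norm. *)
Definition singular_value (R : realType) (n k : nat) (A : 'M[R]_(n, k))
    (a : R) : Prop :=
  0 <= a /\
  exists (u : 'cV[R]_n) (v : 'cV[R]_k),
    [/\ u^T *m u = 1%:M, v^T *m v = 1%:M,
        A *m v = a *: u & A^T *m u = a *: v].

Section RandomVectors.
Context d (T : measurableType d) (R : realType) (P : probability T R).

Definition mutually_independent (n : nat) (X : 'I_n -> {RV P >-> R}) : Prop :=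
  forall (J : {set 'I_n}) (B : 'I_n -> set R),
    (forall i, measurable (B i)) ->
    P [set t | forall i, i \in J -> B i (X i t)]%classic
    = (\prod_(i in J) P (X i @^-1` B i)%classic)%E.

(* The law N(0, sigma^2 I): independent components, each N(0, sigma^2).
   normal_prob takes the standard deviation.  The two laws are compared on
   measurable sets only, as their values elsewhere are meaningless. *)
Definition white_gaussian (n : nat) (sigma : R) (X : 'I_n -> {RV P >-> R}) :
    Prop :=
  mutually_independent X /\
  forall (i : 'I_n) (B : set R), measurable B ->
    distribution P (X i) B = normal_prob 0 sigma B.

Definition random_col (n : nat) (X : 'I_n -> {RV P >-> R}) (t : T) :
    'cV[R]_n :=
  \col_i X i t.

(* The library covariance of two real functions is extended-real valued. *)
Definition cov_mx (n : nat) (X : T -> 'cV[R]_n) : 'M[\bar R]_n :=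
  \matrix_(i < n, j < n) covariance P (fun t => X t i ord0) (fun t => X t j ord0).

End RandomVectors.

Definition least_squares (R : realType) (n k : nat) (A : 'M[R]_(n, k))
    (y : 'cV[R]_n) : 'cV[R]_k :=
  invmx (A^T *m A) *m A^T *m y.

(* Main.v *)
(** With theta_i = pi (i - 1/2) / Ns, midpoint alignment turns row s_i of the
    basis into rho_k cos (theta_i (k - 1)), the DCT-II grid of size Ns.  For
    0 < k < 2 Ns the sum of cos (theta_i k) vanishes, since multiplying it by
    2 sin (pi k / (2 Ns)) makes it telescope to sin (pi k); product-to-sum
    formulas then give the orthogonality of the columns.  The least-squares
    error is a linear image B z of the noise with B B^T = (M / Ns) I, and the
    noise has covariance sigma^2 I: independence kills the off-diagonal terms
    (Fubini), and integration by parts computes the Gaussian moments. *)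

From HB Require Import structures.
Require Import Defs.
From mathcomp Require Import all_boot all_order all_algebra.
From mathcomp Require Import all_classical all_reals all_analysis.
From mathcomp Require Import measurable_realfun.
From mathcomp Require Import ring lra zify.

Import Order.TTheory GRing.Theory Num.Theory.
Import numFieldNormedType.Exports.

Local Open Scope ring_scope.

(** * Cosine sums over the midpoint grid *)

Section CosineSums.
Variable R : realType.
Implicit Types (N k l : nat) (x y : R).

Lemma sin_pi_natmul k : sin (pi * k%:R) = 0 :> R.
Proof.
elim: k => [|k IHk]; first by rewrite mulr0 sin0.
by rewrite -natr1 mulrDr mulr1 sinDpi IHk oppr0.
Qed.

Lemma sum_cos_midpoints N k : (0 < k < N.*2)%N ->
  \sum_(i < N) cos (pi / N%:R * (i.+1%:R - 2^-1) * k%:R) = 0 :> R.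
Proof.
move=> /andP[k0 kN].
have N0 : (0 < N)%N by case: N kN.
have N0R : (N%:R : R) != 0 by rewrite pnatr_eq0 -lt0n.
(* Half the phase increment between neighbouring nodes; [k < N.*2] keeps it strictly between 0 and
   pi, so [sin h] can be cancelled. *)
pose h : R := pi / N%:R * 2^-1 * k%:R.
have sh : sin h != 0.
  rewrite gt_eqF// sin_gt0_pi//; apply/andP; split.
    by rewrite !mulr_gt0 ?pi_gt0 ?invr_gt0 ?ltr0n.
  have -> : h = pi * (k%:R / N.*2%:R) by rewrite /h -muln2 natrM; field.
  by rewrite gtr_pMr ?pi_gt0// ltr_pdivrMr ?ltr0n ?double_gt0// mul1r ltr_nat.
have sh2 : 2 * sin h != 0 by rewrite mulf_neq0.
apply: (mulfI sh2).
pose f (i : nat) : R := sin (pi / N%:R * i%:R * k%:R).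
rewrite mulr0 mulr_sumr.
transitivity (\sum_(i < N) (f i.+1 - f i)).
  apply: eq_bigr => i _.
  set a := cos _.
  have e1 : f i.+1 = sin (pi / N%:R * (i.+1%:R - 2^-1) * k%:R + h).
    by rewrite /f /h; congr sin; rewrite -!mulrDl -!mulrDr subrK.
  have e2 : f i = sin (pi / N%:R * (i.+1%:R - 2^-1) * k%:R - h).
    rewrite /f /h; congr sin; rewrite -natr1 -!mulrBl -!mulrBr.
    by congr (_ * _ * _); lra.
  by rewrite e1 e2 sinD sinB -/a; ring.
rewrite -(big_mkord xpredT (fun i => f i.+1 - f i)) telescope_sumr//.
by rewrite /f mulr0 mul0r sin0 subr0 divfK// sin_pi_natmul.
Qed.

Lemma sum_cos_midpointsM N k l : (k < N)%N -> (l < N)%N ->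
  \sum_(i < N) cos (pi / N%:R * (i.+1%:R - 2^-1) * k%:R)
             * cos (pi / N%:R * (i.+1%:R - 2^-1) * l%:R)
  = if k == l then if k == 0%N then N%:R else N%:R / 2 else 0 :> R.
Proof.
(* Ordering the indices makes the truncated subtraction [k - l] agree with the real difference of
   frequencies. *)
wlog le_lk : k l / (l <= k)%N.
  move=> H kN lN; have [lk|kl] := leqP l k; first exact: H.
  under eq_bigr do rewrite mulrC.
  rewrite H// 1?ltnW// eq_sym.
  by have [->|] := eqVneq k l.
move=> kN lN.
have cosM x y : cos x * cos y = 2^-1 * (cos (x - y) + cos (x + y)).
  by rewrite cosB cosD; field.
under eq_bigr do rewrite cosM -mulrBr -mulrDr -natrB// -natrD.
rewrite -mulr_sumr big_split/=.
have [<-|nkl] := eqVneq k l.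
  rewrite subnn; under eq_bigr do rewrite mulr0 cos0.
  rewrite sumr_const card_ord.
  have [->|k0] := eqVneq k 0%N.
    under eq_bigr do rewrite addn0 mulr0 cos0.
    by rewrite sumr_const card_ord; field.
  by rewrite sum_cos_midpoints ?addr0 1?mulrC//; lia.
(* For [l < k < N], both [k - l] and [k + l] lie strictly between 0 and [2N]. *)
by rewrite !sum_cos_midpoints ?addr0 ?mulr0//; lia.
Qed.

End CosineSums.

(** * Gram matrix and singular values of the sampled basis *)

Lemma midpoint_aligned_inj (R : realType) (M N : nat) (s : 'I_N -> 'I_M) :
  @midpoint_aligned R M N s -> injective s.
Proof.
move=> hs i j sij; have := hs j; rewrite -sij hs.
have N0 : (0 < N)%N by case: N i {hs j sij} s => // -[].
have N0R : (N%:R : R) != 0 by rewrite pnatr_eq0 -lt0n.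
move=> /(mulIf (invr_neq0 N0R)) /addIr /eqP.
by rewrite eqr_nat eqSS => /eqP /val_inj.
Qed.

(** A Gram entry is a sum over rows, so the order in which [enum_val] lists [S] does not matter and
    [s] may reindex it; injectivity prevents double counting. *)
Lemma gram_rows_of (R : realType) (M K N : nat) (S : {set 'I_M})
    (s : 'I_N -> 'I_M) (A : 'M[R]_(M, K)) (k l : 'I_K) :
  injective s -> S = [set s i | i : 'I_N]%SET ->
  ((rows_of S A)^T *m rows_of S A) k l = \sum_(i < N) A (s i) k * A (s i) l.
Proof.
move=> s_inj ->; rewrite mxE.
under eq_bigr do rewrite !mxE.
rewrite -(big_enum_val (fun m => A m k * A m l)).
by rewrite big_imset//= => i j _ _; exact: s_inj.
Qed.

Lemma gram_dct_midpoints (R : realType) (M K N : nat) (S : {set 'I_M})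
    (s : 'I_N -> 'I_M) :
  (0 < M)%N -> (K <= N)%N -> S = [set s i | i : 'I_N]%SET ->
  @midpoint_aligned R M N s ->
  (rows_of S (dct_basis R M K))^T *m rows_of S (dct_basis R M K)
  = (N%:R / M%:R) *: 1%:M.
Proof.
move=> M0 KN hS hs; apply/matrixP => k l.
have M0R : (M%:R : R) != 0 by rewrite pnatr_eq0 -lt0n.
rewrite (gram_rows_of _ _ _ _ _ s)//; last exact: midpoint_aligned_inj hs.
rewrite !mxE.
transitivity (dct_scale R M k * dct_scale R M l *
    \sum_(i < N) cos (pi / N%:R * (i.+1%:R - 2^-1) * k%:R)
             * cos (pi / N%:R * (i.+1%:R - 2^-1) * l%:R)).
  rewrite mulr_sumr; apply: eq_bigr => i _; rewrite !mxE.
  (* Regrouping exposes the quotient in [midpoint_aligned], which moves each angle from the grid of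
     size [M] to that of size [N]. *)
  by rewrite mulrACA -!(mulrA pi) !(mulrC _^-1) !hs.
rewrite sum_cos_midpointsM ?(leq_trans (ltn_ord _) KN)//.
have [->|nkl] := eqVneq k l; last first.
  by rewrite (negbTE (_ : nat_of_ord k != l)) ?mulr0.
rewrite eqxx /dct_scale mulr1.
(* Both normalizations give the same value: (1/M) N for the constant column, (2/M)(N/2) for the
   others. *)
case: ifP => _; rewrite -expr2 sqr_sqrtr ?divr_ge0//.
  by rewrite mulrC mul1r.
by field; rewrite M0R.
Qed.

(** A singular pair satisfies A^T A v = a^2 v, which forces a^2 = c. Conversely any unit v works,
    with u = A v / sqrt c; [0 < k] supplies a basis vector. *)
Lemma singular_value_scaled_isometry (R : realType) (n k : nat)
    (A : 'M[R]_(n, k)) (c a : R) :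
  (0 < k)%N -> 0 < c -> A^T *m A = c *: 1%:M ->
  singular_value A a <-> a = Num.sqrt c.
Proof.
move=> k0 c0 AA; split.
  move=> [a0 [u [v [_ vv Av Au]]]].
  have : A^T *m A *m v = a ^+ 2 *: v.
    by rewrite -mulmxA Av -scalemxAr Au scalerA.
  rewrite AA -scalemxAl mul1mx => /(congr1 (mulmx v^T)).
  rewrite -!scalemxAr vv => /matrixP /(_ ord0 ord0).
  by rewrite !mxE/= !mulr1 => ->; rewrite sqrtr_sqr ger0_norm.
move=> ->; split; first exact: sqrtr_ge0.
have sc0 : Num.sqrt c != 0 by rewrite gt_eqF// sqrtr_gt0.
have sc2 : Num.sqrt c * Num.sqrt c = c by rewrite -expr2 sqr_sqrtr// ltW.
pose v : 'cV[R]_k := delta_mx (Ordinal k0) ord0.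
have vv : v^T *m v = 1%:M.
  rewrite /v trmx_delta mul_delta_mx; apply/matrixP => i j.
  by rewrite !ord1 !mxE.
exists ((Num.sqrt c)^-1 *: (A *m v)), v; split=> //.
- rewrite -scalemxAr [_^T]linearZ/= -scalemxAl scalerA trmx_mul -mulmxA.
  by rewrite [A^T *m _]mulmxA AA -scalemxAl mul1mx -scalemxAr vv scalerA
    -invfM sc2 mulVf ?gt_eqF// scale1r.
- by rewrite scalerA mulfV// scale1r.
- rewrite -scalemxAr mulmxA AA -scalemxAl mul1mx scalerA.
  by rewrite -[in RHS](mulfK sc0 (Num.sqrt c)) sc2 mulrC.
Qed.

Local Open Scope classical_set_scope.

(** * Moments of the Gaussian density *)

Section NormalMoments.
Variable R : realType.
Local Notation mu := (@lebesgue_measure R).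
Variable sigma : R.
Hypothesis sigma0 : 0 < sigma.
Local Notation g := (normal_pdf 0 sigma).

Let sigmaN0 : sigma != 0. Proof. by rewrite gt_eqF. Qed.

Lemma is_derive_normal_pdf (x : R) :
  is_derive x 1 g (- (x / sigma ^+ 2) * g x).
Proof.
rewrite normal_pdfE// /normal_fun.
apply: is_derive_eq.
by rewrite /GRing.scale/=; field.
Qed.

Lemma normal_pdfN x : g (- x) = g x.
Proof. by rewrite normal_pdfE// /normal_fun !subr0 sqrrN. Qed.

(** This is the boundary term of the integration by parts. With y = n^2 / (2 sigma^2), the bound exp
    y >= 1 + y > y gives n exp(-y) <= 2 sigma^2 / n. *)
Lemma cvg_mul_normal_pdf : (n%:R * g n%:R) @[n --> \oo] --> (0 : R).
Proof.
apply: (@squeeze_cvgr _ _ _ _ (cst 0)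
  (fun n => normal_peak sigma * (sigma ^+ 2 * (2 / n%:R)))).
- near=> n; apply/andP; split; first by rewrite mulr_ge0 ?normal_pdf_ge0.
  have n0 : 0 < n%:R :> R by rewrite ltr0n; near: n; exact: nbhs_infty_gt.
  rewrite normal_pdfE// mulrCA ler_wpM2l ?normal_peak_ge0//.
  rewrite /normal_fun subr0 mulNr expRN.
  set y := n%:R ^+ 2 / (sigma ^+ 2 *+ 2).
  have y0 : 0 < y by rewrite /y divr_gt0 ?exprn_gt0// mulrn_wgt0// exprn_gt0.
  rewrite ler_pdivrMr ?expR_gt0//.
  apply: (@le_trans _ _ (sigma ^+ 2 * (2 / n%:R) * y)).
    rewrite /y -mulr_natr le_eqVlt; apply/orP; left; apply/eqP; field.
    by rewrite sigmaN0 gt_eqF.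
  rewrite ler_wpM2l ?mulr_ge0 ?exprn_ge0 ?invr_ge0 ?ltW//.
  by apply: lt_le_trans (expR_ge1Dx y); rewrite ltrDr.
- exact: cvg_cst.
- rewrite (_ : (fun _ => _) =
      (fun n => normal_peak sigma * sigma ^+ 2 * 2 * n%:R^-1)); last first.
    by apply/funext => n; rewrite !mulrA.
  rewrite -[X in _ --> X](mulr0 (normal_peak sigma * sigma ^+ 2 * 2)).
  apply: cvgMr; apply/gtr0_cvgV0; last exact: cvgr_idn.
  by near=> n; rewrite ltr0n; near: n; exact: nbhs_infty_gt.
Unshelve. all: by end_near. Qed.

Lemma integral_sqr_normal_pdf_itv (a b : R) : 0 < b ->
  (\int[mu]_(x in `[(- b)%R, b]) ((x + a) ^+ 2 * g x)%:E =
   (sigma ^+ 2 + a ^+ 2)%:E * \int[mu]_(x in `[(- b)%R, b]) (g x)%:E +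
   (- sigma ^+ 2 * (2 * b * g b))%:E)%E.
Proof.
move=> b0.
have gD := is_derive_normal_pdf.
(* Since g' = -(x / sigma^2) g, this is an antiderivative of ((x + a)^2 - sigma^2 - a^2) g. Evenness
   of g cancels the 2a in [F b - F (- b)]. *)
pose F x := - sigma ^+ 2 * ((x + 2 * a) * g x).
pose f x := (x + a) ^+ 2 * g x - (sigma ^+ 2 + a ^+ 2) * g x.
have FD (x : R) : is_derive x 1 F (f x).
  apply: is_derive_eq.
  by rewrite /GRing.scale/= /f; field.
have fD (x : R) : derivable f x 1 by apply: ex_derive.
have FNb : - sigma ^+ 2 * (2 * b * g b) = F b - F (- b).
  by rewrite /F normal_pdfN; ring.
have gi : mu.-integrable `[(- b)%R, b] (EFin \o g).
  apply: (integrableS measurableT) => //; exact: integrable_normal_pdf.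
have fi : mu.-integrable `[(- b)%R, b] (EFin \o f).
  apply: continuous_compact_integrable; first exact: segment_compact.
  exact: derivable_within_continuous.
rewrite FNb EFinB -(@continuous_FTC2 _ f)//; first last.
- by move=> x _; rewrite derive1E derive_val.
- split => [x _||].
  + exact: ex_derive.
  + apply: cvg_at_right_filter. apply: differentiable_continuous.
    by apply/derivable1_diffP; exact: ex_derive.
  + apply: cvg_at_left_filter. apply: differentiable_continuous.
    by apply/derivable1_diffP; exact: ex_derive.
- by apply: derivable_within_continuous => x _.
- by rewrite (lt_trans _ b0)// oppr_lt0.
rewrite -integralZl// -integralD//; last exact: integrableZl.
by apply: eq_integral => x _; rewrite /= -EFinM -EFinD /f; congr EFin; ring.
Qed.

(* Comparing a = 0 and a = 1 yields the mean as well, without any symmetry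
   argument. *)
Lemma integral_sqr_normal_pdf a :
  (\int[mu]_x ((x + a) ^+ 2 * g x)%:E = (sigma ^+ 2 + a ^+ 2)%:E)%E.
Proof.
(* These intervals exhaust the line, so monotone convergence reduces the claim to the truncated
   formula, applied for n > 0 and hence only eventually. *)
pose D (n : nat) : set R := `[- n%:R, n%:R]%classic.
have UD : \bigcup_n D n = [set: R].
  apply/seteqP; split=> // x _.
  exists (Num.bound x) => //; rewrite /D/= in_itv/= -ler_norml ltW//.
  exact: unstable.ltr_norm_bound.
have nD : nondecreasing_seq D.
  move=> m n mn; apply/subsetPset => y; rewrite /D/= !in_itv/= -!ler_norml.
  by move=> /le_trans; apply; rewrite ler_nat.
have cvgD (h : R -> R) : (forall x, 0 <= h x) -> measurable_fun setT h ->
    (\int[mu]_(x in D n) (h x)%:E)%E @[n --> \oo] --> (\int[mu]_x (h x)%:E)%E.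
  move=> h0 mh; rewrite -UD; apply: ge0_nondecreasing_set_cvg_integral => //.
  - by move=> n; exact: measurable_itv.
  - by move=> n; apply/measurable_EFinP; exact: measurable_funTS.
  - by move=> n x _; rewrite lee_fin.
have mg := measurable_normal_pdf 0 sigma.
have ge0h x : 0 <= (x + a) ^+ 2 * g x.
  by rewrite mulr_ge0 ?sqr_ge0 ?normal_pdf_ge0.
have mh : measurable_fun [set: R] (fun x : R => (x + a) ^+ 2 * g x).
  apply: measurable_funM => //; apply: measurable_funX.
  exact: measurable_funD.
apply: (cvg_unique _ (cvgD _ ge0h mh)) => //.
have : ((sigma ^+ 2 + a ^+ 2)%:E * \int[mu]_(x in D n) (g x)%:E
    + (- sigma ^+ 2 * 2 * (n%:R * g n%:R))%:E)%E @[n --> \oo]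
    --> ((sigma ^+ 2 + a ^+ 2)%:E * 1 + (- sigma ^+ 2 * 2 * 0)%:E)%E.
  apply: cvgeD => //.
  - apply: cvgeZl => //; rewrite -(integral_normal_pdf 0 sigma).
    by apply: cvgD => // x; exact: normal_pdf_ge0.
  - apply: cvg_EFin; first exact: nearW.
    by apply: cvgMr; exact: cvg_mul_normal_pdf.
rewrite mulr0 mule1 adde0; apply: cvg_trans.
apply: near_eq_cvg; near=> n.
rewrite integral_sqr_normal_pdf_itv ?mulrA// ltr0n.
by near: n; exact: nbhs_infty_gt.
Unshelve. all: by end_near. Qed.

End NormalMoments.

(** Change of variables produces the abstract Radon-Nikodym derivative; it equals [normal_pdf]
    almost everywhere because both have the same integral over every measurable set. *)
Lemma ge0_integral_normal_prob (R : realType) (m sigma : R) (f : R -> \bar R) :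
  measurable_fun [set: R] f -> (forall x, 0 <= f x)%E ->
  (\int[normal_prob m sigma]_x f x =
   \int[lebesgue_measure]_x (f x * (normal_pdf m sigma x)%:E))%E.
Proof.
move=> mf f0.
pose mu := @lebesgue_measure R.
have dom := normal_prob_dominates m sigma.
rewrite -(Radon_Nikodym_SigmaFinite.change_of_variables dom)//.
apply: ae_eq_integral => //.
- apply: emeasurable_funM => //; apply: (measurable_int mu).
  exact: Radon_Nikodym_SigmaFinite.f_integrable.
- apply: emeasurable_funM => //=; apply/measurableT_comp => //=.
  exact: measurable_normal_pdf.
- apply: ae_eqe_mul2l => /=.
  apply: integral_ae_eq => //=.
  + exact: Radon_Nikodym_SigmaFinite.f_integrable.
  + by apply/measurableT_comp => //; exact: measurable_normal_pdf.
  + by move=> E E01 mE; rewrite -Radon_Nikodym_SigmaFinite.f_integral.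
Qed.

(** * Independence and vanishing covariance *)

Section RandomVariables.
Context d (T : measurableType d) (R : realType) (P : probability T R).

(** Independence says that the joint law agrees with the product of the marginals on rectangles,
    hence everywhere by uniqueness of the product measure; Fubini then factors the integral of
    xy. *)
Lemma independent_expectationM (X Y : {RV P >-> R}) :
  (forall A B : set R, measurable A -> measurable B ->
    P (X @^-1` A `&` Y @^-1` B) = (P (X @^-1` A) * P (Y @^-1` B))%E) ->
  (X : T -> R) \in Lfun P 1 -> (Y : T -> R) \in Lfun P 1 ->
  (X : T -> R) * (Y : T -> R) \in Lfun P 1 ->
  ('E_P[(X : T -> R) * (Y : T -> R)] = 'E_P[X] * 'E_P[Y])%E.
Proof.
move=> XYind X1 Y1 XY1.
have mXY : measurable_fun [set: T] (fun t => (X t, Y t)).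
  by apply: measurable_fun_pair.
pose Z : {RV P >-> (R * R)%type} :=
  HB.pack (fun t => (X t, Y t)) (isMeasurableFun.Build _ _ _ _ _ mXY).
pose f (p : R * R) : \bar R := (p.1 * p.2)%:E.
have mf : measurable_fun [set: R * R] f.
  by apply/measurable_EFinP; apply: measurable_funM.
have jointE A : measurable A ->
    (distribution P X \x distribution P Y)%E A = distribution P Z A.
  apply: product_measure_unique => B C mB mC.
  exact: XYind.
have XYi : P.-integrable [set: T] (f \o Z).
  exact/Lfun1_integrable.
(* Fubini needs integrability for the product law; it is pulled back through the joint law to that
   of XY. *)
have fi : (distribution P X \x distribution P Y)%E.-integrable [set: R * R] f.
  apply/integrableP; split => //.
  rewrite (eq_measure_integral (distribution P Z))/=; last first.
    by move=> A mA _; exact: jointE.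
  rewrite ge0_integral_distribution//; last first.
    apply/measurable_EFinP; apply: measurableT_comp => //.
    exact: measurable_funM.
  by case/integrableP : XYi.
rewrite [in LHS]unlock.
transitivity (\int[distribution P Z]_p f p)%E.
  by rewrite integral_distribution.
rewrite (eq_measure_integral (distribution P X \x distribution P Y)%E).
2: by move=> A mA _; apply/esym; exact: jointE.
rewrite -integral12_prod_meas1// /fubini_F.
have Xi : P.-integrable [set: T] (EFin \o X) by exact/Lfun1_integrable.
have Yi : P.-integrable [set: T] (EFin \o Y) by exact/Lfun1_integrable.
(* A finite mean makes the inner integral a real multiple of x, so linearity applies to the outer
   one. *)
have [c EY] : exists c, ('E_P[Y] = c%:E)%E.
  by exists (fine 'E_P[Y]%E); rewrite fineK// expectation_fin_num.
have inner (x : R) : (\int[distribution P Y]_y f (x, y) = c%:E * x%:E)%E.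
  rewrite integral_distribution//=.
  - rewrite -EY /f/= unlock muleC -integralZl//.
  - apply/measurable_EFinP; apply: measurable_funM;
      [exact: measurable_cst|exact: measurable_id].
  - by rewrite /f/=; under eq_fun do rewrite EFinM; exact: integrableZl.
under eq_integral do rewrite inner.
rewrite integral_distribution//.
- by rewrite EY /= integralZl// unlock muleC.
- apply/measurable_EFinP; apply: measurable_funM;
      [exact: measurable_cst|exact: measurable_id].
- exact: integrableZl.
Qed.

Lemma independent_covariance0 (X Y : {RV P >-> R}) :
  (forall A B : set R, measurable A -> measurable B ->
    P (X @^-1` A `&` Y @^-1` B) = (P (X @^-1` A) * P (Y @^-1` B))%E) ->
  (X : T -> R) \in Lfun P 2%:E -> (Y : T -> R) \in Lfun P 2%:E ->
  (covariance P X Y = 0)%E.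
Proof.
move=> XYind X2 Y2.
have X1 := Lfun_subset12 (fin_num_measure P _ measurableT) X2.
have Y1 := Lfun_subset12 (fin_num_measure P _ measurableT) Y2.
have XY1 := Lfun2_mul_Lfun1 X2 Y2.
rewrite covarianceE// independent_expectationM// subee//.
by rewrite fin_numM// expectation_fin_num.
Qed.

Lemma sqr_integrable_Lfun2 (X : {RV P >-> R}) :
  P.-integrable [set: T] (fun t => (X t ^+ 2)%:E) ->
  (X : T -> R) \in Lfun P 2%:E.
Proof.
move=> /integrableP[_ Xi].
rewrite inE; apply/andP; split; first by rewrite inE/=.
rewrite inE/= /finite_norm unlock poweR_lty//.
apply: le_lt_trans Xi.
by under eq_integral => x _ do rewrite /= powR_mulrn// -normrX.
Qed.

Lemma mutually_independent_covariance0 (n : nat)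
    (X : 'I_n -> {RV P >-> R}) i j :
  mutually_independent X -> i != j ->
  (forall i, (X i : T -> R) \in Lfun P 2%:E) ->
  (covariance P (X i) (X j) = 0)%E.
Proof.
move=> ind nij X2; apply: independent_covariance0 => // A B mA mB.
(* Only the values at [i] and [j] are tested, so a single conditional encodes the pair [A], [B]. *)
have := ind [set i; j]%SET (fun k => if k == i then A else B).
rewrite big_setU1 ?inE//= big_set1 eqxx eq_sym (negbTE nij) => <-; last first.
  by move=> k; case: ifP.
congr (P _); apply/seteqP; split => t /=.
  move=> [At Bt] k; rewrite !inE => /orP[] /eqP -> //; rewrite ?eqxx//.
  by rewrite eq_sym (negbTE nij).
move=> H; split.
  by have := H i; rewrite !inE !eqxx; exact.
by have := H j; rewrite !inE !eqxx orbT eq_sym (negbTE nij); exact.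
Qed.

(** * Mean and variance of a normal random variable *)

Section Normal.
Variables (sigma : R) (X : {RV P >-> R}).
Hypothesis sigma0 : 0 < sigma.
Hypothesis lawX : forall B : set R, measurable B ->
  distribution P X B = normal_prob 0 sigma B.

(** The integrand is nonnegative, so it can be transported along the law before any integrability is
    known; square integrability of X is then deduced from this value. *)
Lemma normal_shifted_second_moment (a : R) :
  (\int[P]_t ((X t + a) ^+ 2)%:E = (sigma ^+ 2 + a ^+ 2)%:E)%E.
Proof.
have mf : measurable_fun [set: R] (fun x : R => ((x + a) ^+ 2)%:E).
  by apply/measurable_EFinP; apply: measurable_funX; exact: measurable_funD.
(* The normal law lives on a copy of R whose measurable structure has another
   display; integrals for the two displays are not convertible. *)
pose X' : {RV P >-> measurableTypeR R} :=
  HB.pack (X : T -> measurableTypeR R)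
    (isMeasurableFun.Build _ _ _ (measurableTypeR R) _
      (@measurable_funPT _ _ _ _ X)).
have -> : (\int[P]_t ((X t + a) ^+ 2)%:E =
    \int[distribution P X']_x ((x + a) ^+ 2)%:E)%E.
  by rewrite ge0_integral_distribution// => x; rewrite lee_fin sqr_ge0.
rewrite (eq_measure_integral (normal_prob 0 sigma)); last first.
  by move=> A mA _; exact: lawX.
rewrite ge0_integral_normal_prob//; last by move=> x; rewrite lee_fin sqr_ge0.
exact: integral_sqr_normal_pdf.
Qed.

Lemma normal_second_moment : (\int[P]_t (X t ^+ 2)%:E = (sigma ^+ 2)%:E)%E.
Proof.
have := normal_shifted_second_moment 0; rewrite expr0n addr0 => <-.
by apply: eq_integral => t _; rewrite addr0.
Qed.

Lemma normal_Lfun2 : (X : T -> R) \in Lfun P 2%:E.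
Proof.
apply: sqr_integrable_Lfun2; apply/integrableP; split.
  by apply/measurable_EFinP; apply: measurable_funX.
rewrite (eq_integral (fun t => (X t ^+ 2)%:E)).
  by rewrite normal_second_moment ltry.
by move=> t _; rewrite /= ger0_norm ?sqr_ge0.
Qed.

Lemma normal_expectation : ('E_P[X] = 0)%E.
Proof.
have X2 := normal_Lfun2.
have X1 := Lfun_subset12 (fin_num_measure P _ measurableT) X2.
have XX1 := Lfun2_mul_Lfun1 X2 X2.
have C1 : (cst 1 : T -> R) \in Lfun P 1 by exact: Lfun_cst.
have Z1 : 2 \o* (X : T -> R) \in Lfun P 1 by exact: Lfun_scale.
have m0 : ('E_P[(X \* X)%R] = (sigma ^+ 2)%:E)%E.
  by rewrite -normal_second_moment unlock.
(* This is E (X + 1)^2 = sigma^2 + 1 expanded; subtracting E X^2 = sigma^2 and 1 leaves 2 E X =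
   0. *)
have : ('E_P[((X \* X) \+ (2 \o* (X : T -> R) \+ cst 1))%R] =
    (sigma ^+ 2 + 1 ^+ 2)%:E)%E.
  rewrite unlock -normal_shifted_second_moment; apply: eq_integral => t _ /=.
  by congr EFin; ring.
rewrite expectationD ?rpredD// expectationD// expectationZl//.
rewrite expectation_cst m0.
have : 'E_P[X]%E \is a fin_num by exact: expectation_fin_num.
case: 'E_P[X]%E => // r _; rewrite -EFinM -!EFinD => -[] rE.
by congr EFin; lra.
Qed.

Lemma normal_variance : covariance P X X = (sigma ^+ 2)%:E.
Proof.
have X2 := normal_Lfun2.
rewrite -/(variance P X) varianceE// normal_expectation expe2 mule0 sube0.
by rewrite -normal_second_moment unlock.
Qed.

End Normal.

(** * Covariance of affine images *)

Lemma Lfun2_lincomb (I : Type) (s : seq I) (a : I -> R) (X : I -> T -> R) :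
  (forall i, X i \in Lfun P 2%:E) ->
  (fun t => \sum_(i <- s) a i * X i t) \in Lfun P 2%:E.
Proof.
move=> X2.
rewrite (_ : (fun _ => _) = \sum_(i <- s) (a i \o* X i)).
  apply: rpred_sum; first by rewrite lee1n.
  by move=> p1 i _; apply: Lfun_scale; rewrite ?ler1n.
by apply/funext => t; rewrite fct_sumE; apply: eq_bigr => i _ /=; rewrite mulrC.
Qed.

Lemma covariance_affinel (I : Type) (s : seq I) (c : R) (a : I -> R)
    (X : I -> T -> R) (Y : T -> R) :
  (forall i, X i \in Lfun P 2%:E) -> Y \in Lfun P 2%:E ->
  (covariance P (fun t => (c + \sum_(i <- s) a i * X i t)%R) Y =
   \sum_(i <- s) (a i)%:E * covariance P (X i) Y)%E.
Proof.
move=> X2 Y2.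
rewrite (_ : (fun _ => _) = cst c \+ (fun t => \sum_(i <- s) a i * X i t))//.
rewrite covarianceDl ?Lfun_cst ?Lfun2_lincomb// covariance_cst_l add0e.
elim: s => [|i s IHs].
  rewrite big_nil (_ : (fun _ => _) = cst 0) ?covariance_cst_l//.
  by apply/funext => t; rewrite big_nil.
rewrite big_cons (_ : (fun _ => _) =
    a i \o* X i \+ (fun t => \sum_(i <- s) a i * X i t)); last first.
  by apply/funext => t; rewrite big_cons/= mulrC.
rewrite covarianceDl ?Lfun_scale ?ler1n ?Lfun2_lincomb// IHs covarianceZl//.
- exact: Lfun_subset12 (fin_num_measure P _ measurableT) _ (X2 i).
- exact: Lfun_subset12 (fin_num_measure P _ measurableT) _ Y2.
- exact: Lfun2_mul_Lfun1.
Qed.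

Lemma cov_mx_affine (n k : nat) (v : R) (w : 'cV[R]_k) (B : 'M[R]_(k, n))
    (z : 'I_n -> {RV P >-> R}) :
  (forall i, (z i : T -> R) \in Lfun P 2%:E) ->
  (forall i j, covariance P (z i) (z j) = (v *+ (i == j))%:E) ->
  cov_mx P (fun t => w + B *m random_col z t)
  = map_mx EFin (v *: (B *m B^T)).
Proof.
move=> z2 zC; apply/matrixP => i j; rewrite !mxE.
have E l : (fun t => (w + B *m random_col z t) l ord0) =
    (fun t => w l ord0 + \sum_m B l m * z m t).
  by apply/funext => t; rewrite !mxE; under eq_bigr do rewrite mxE.
have z2' l : (fun t => w l ord0 + \sum_m B l m * z m t) \in Lfun P 2%:E.
  apply: rpredD => [|p1|p1].
  - by rewrite lee1n.
  - exact: Lfun_cst.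
  - exact: Lfun2_lincomb.
rewrite !E covariance_affinel// mulr_sumr -sumEFin; apply: eq_bigr => m _.
(* Symmetry lets the left-hand expansion serve for the second argument too; uncorrelated noise
   leaves only the index [m] in the inner sum. *)
rewrite covarianceC covariance_affinel// (bigD1 m)//= zC eqxx mulr1n.
rewrite big1 ?adde0.
  by rewrite -!EFinM mxE; congr EFin; ring.
by move=> l lm; rewrite zC (negbTE lm) mulr0n mule0.
Qed.

End RandomVariables.

(** * The least-squares estimator and its covariance *)

Lemma least_squares_scaled_isometry (R : realType) (n k : nat)
    (A : 'M[R]_(n, k)) (c : R) (x : 'cV[R]_k) (e : 'cV[R]_n) :
  c != 0 -> A^T *m A = c *: 1%:M ->
  least_squares A (A *m x + e) = x + (c^-1 *: A^T) *m e.
Proof.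
move=> c0 AA; rewrite /least_squares AA.
rewrite scalemx1 invmx_scalar mul_scalar_mx mulmxDr -!scalemxAl mulmxA AA.
by rewrite -scalemxAl mul1mx scalerA mulVf// scale1r.
Qed.

Theorem proposition2 (R : realType) (M K Ns : nat) (S : {set 'I_M})
    (s : 'I_Ns -> 'I_M)
    (hK : (1 <= K <= M)%N)
    (hS : S = [set s i | i : 'I_Ns]%SET)
    (hs : @midpoint_aligned R M Ns s)
    (hKN : (K <= Ns)%N) :
  let PsiS := rows_of S (dct_basis R M K) in
  [/\ PsiS^T *m PsiS = (Ns%:R / M%:R) *: 1%:M,
      (forall a : R, singular_value PsiS a <-> a = Num.sqrt (Ns%:R / M%:R)) &
      (forall (d : measure_display) (T : measurableType d) (P : probability T R)
         (sigma : R) (omega : 'cV[R]_K) (z : 'I_#|S| -> {RV P >-> R}),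
         0 < sigma ->
         white_gaussian sigma z ->
         let y := fun t : T => PsiS *m omega + random_col z t in
         cov_mx P (fun t => least_squares PsiS (y t))
         = map_mx EFin ((sigma ^+ 2 * (M%:R / Ns%:R)) *: 1%:M))].
Proof.
have [K0 KM] := andP hK.
have M0 : (0 < M)%N := leq_trans K0 KM.
have Ns0 : (0 < Ns)%N := leq_trans K0 hKN.
move=> PsiS.
have c0 : 0 < Ns%:R / M%:R :> R by rewrite divr_gt0 ?ltr0n.
have gram : PsiS^T *m PsiS = (Ns%:R / M%:R) *: 1%:M.
  exact: gram_dct_midpoints hS hs.
split => //.
  by move=> a; exact: singular_value_scaled_isometry.
move=> d T P sigma omega z sigma0 [zind zlaw] y.
have z2 i : (z i : T -> R) \in Lfun P 2%:E.
  exact: normal_Lfun2 sigma0 (zlaw i).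
(* For every outcome the estimator is the true coefficient vector plus a fixed linear image of the
   noise. *)
rewrite (_ : (fun t => _) =
    (fun t => omega + ((Ns%:R / M%:R)^-1 *: PsiS^T) *m random_col z t)).
  rewrite (@cov_mx_affine _ _ _ _ _ _ (sigma ^+ 2))//.
    (* With c = Ns / M, the Gram identity turns B B^T into c^-2 c I = c^-1 I. *)
    rewrite linearZ/= trmxK -scalemxAl -scalemxAr gram !scalerA invf_div.
    by congr (map_mx _ (_ *: _)); field; rewrite !pnatr_eq0 -!lt0n Ns0 M0.
  move=> i j; have [<-|nij] := eqVneq i j.
    exact: normal_variance sigma0 (zlaw i).
  exact: mutually_independent_covariance0 zind nij z2.
apply/funext => t.
exact: (least_squares_scaled_isometry _ _ _ _ _ _ _ (lt0r_neq0 c0)).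
Qed.
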